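(* Let $\mathfrak J_{\mathrm{gen}}$ be a generating collection of partitions. Suppose that: - $\psi:\mathcal C\to\mathbb R$ is $\mathcal C^*$-increasing; - $\mathsf H:\mathcal H\to\mathbb R$ is continuous; - for each $j\in\mathfrak J_{\mathrm{gen}}$, $f_j:\mathbb R_+\times\mathcal C^j\to(-\infty,\infty]$ is given by $$f_j(t,x)=\sup_{z\in\mathcal C^j}\inf_{y\in\mathcal C^j}\big\{\psi^j(y)+\langle x-y,z\rangle_{\mathcal H^j}+t\,\mathsf H^j(z)\big\},\quad\forall(t,x)\in\mathbb R_+\times\mathcal C^j.$$ If $\lim_{j\in\mathfrak J_{\mathrm{gen}}}f_j^\uparrow(t,\mu)$ exists in $\mathbb R$ at some $(t,\mu)\in\mathbb R_+\times\mathcal C$, then the limit is equal to $$f(t,\mu)=\sup_{\rho\in\mathcal C}\inf_{\nu\in\mathcal C}\big\{\psi(\nu)+\langle\mu-\nu,\rho\rangle_{\mathcal H}+t\,\mathsf H(\rho)\big\}.$$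
   Context: $\mathbb R_+=[0,\infty)$. Fix an integer $D\ge1$. $\mathbb S^D$ is the space of real symmetric $D\times D$ matrices with inner product $a\cdot b=\mathrm{tr}(ab)$ and norm $|a|=\sqrt{a\cdot a}$; $\mathbb S^D_+$ is the cone of positive semidefinite matrices; $a\ge b$ means $a-b\in\mathbb S^D_+$. $\mathcal H=L^2([0,1);\mathbb S^D)$ (Lebesgue measure) with $\langle\iota,\kappa\rangle_{\mathcal H}=\int_0^1\iota(s)\cdot\kappa(s)\,ds$. $\mathcal C\subset\mathcal H$ is the closed convex cone of (classes of) functions $\mu:[0,1)\to\mathbb S^D_+$ that are square-integrable, right-continuous with left limits, and increasing, i.e. $\mu(t)-\mu(s)\in\mathbb S^D_+$ for $t\ge s$. $\mathcal C^*=\{\iota\in\mathcal H:\langle\iota,\mu\rangle_{\mathcal H}\ge0\ \forall\mu\in\mathcal C\}$; $g:\mathcal C\to\mathbb R$ is $\mathcal C^*$-increasing if $g(\mu)\ge g(\mu')$ whenever $\mu-\mu'\in\mathcal C^*$. Partitions. A partition is a tuple $j=(t_1,\dots,t_n)$ with $0<t_1<\dots<t_n=1$; $|j|=n$, $t_0=0$. Partitions are ordered by inclusion of the underlying sets. A collection of partitions is directed if any two members are both included in a third member; it is generating if it is directed and the sigma-algebras generated by the intervals $[t_{k-1},t_k)$, $1\le k\le|j|$, over all its members $j$, together generate the Borel sigma-algebra of $[0,1)$. For nets indexed by a directed collection, $\lim_jx_j=x$ means: for each neighborhood $\mathcal N$ of $x$ there is a member $j_{\mathcal N}$ with $x_j\in\mathcal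 N$ for all members $j\supset j_{\mathcal N}$. For a partition $j$: $\mathcal H^j=(\mathbb S^D)^{|j|}$ with $\langle x,y\rangle_{\mathcal H^j}=\sum_k(t_k-t_{k-1})x_k\cdot y_k$; $\mathcal C^j=\{x\in\mathcal H^j:0\le x_1\le\dots\le x_{|j|}\}$; $\mathrm p_j:\mathcal H\to\mathcal H^j$, $(\mathrm p_j\iota)_k=\frac1{t_k-t_{k-1}}\int_{t_{k-1}}^{t_k}\iota(s)ds$; $\mathrm l_j:\mathcal H^j\to\mathcal H$, $\mathrm l_jx=\sum_kx_k\mathbf 1_{[t_{k-1},t_k)}$; $\psi^j=\psi\circ\mathrm l_j$ on $\mathcal C^j$, $\mathsf H^j=\mathsf H\circ\mathrm l_j$ on $\mathcal H^j$; for $g$ on $\mathbb R_+\times\mathcal C^j$, $g^\uparrow(t,\mu)=g(t,\mathrm p_j\mu)$ on $\mathbb R_+\times\mathcal C$. No assumption is made that $f_j$ or $f$ solves any equation. *)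

(* Defs.v *)
From HB Require Import structures.
From mathcomp Require Import all_boot all_order all_algebra.
From mathcomp Require Import all_classical all_reals all_analysis.

Set Implicit Arguments.
Unset Strict Implicit.
Unset Printing Implicit Defensive.

Import Order.TTheory GRing.Theory Num.Theory.
Import numFieldNormedType.Exports.

Local Open Scope classical_set_scope.
Local Open Scope ring_scope.

Definition I01 (R : realType) : set R := `[0, 1[%classic.
Arguments I01 {R}.

Definition dotS (R : realType) (D : nat) (a b : 'M[R]_D) : R := \tr (a *m b).

Definition symS (R : realType) (D : nat) : set 'M[R]_D := [set a | a^T = a].

Definition psdS (R : realType) (D : nat) : set 'M[R]_D :=
  [set a | symS a /\ forall v : 'cV[R]_D, 0 <= (v^T *m a *m v) 0 0].

(* Elements of H = L^2([0,1); S^D) are handled, as in the Lp spaces of the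
   library, through their representatives: L2S is the set of all
   representatives of all classes. Functions are total on R, but only their
   values on [0,1) matter. *)
Definition L2S (R : realType) (D : nat) : set (R -> 'M[R]_D) :=
  [set f | [/\ forall s, I01 s -> symS (f s),
               forall i k, measurable_fun I01 (fun s => f s i k) &
               (@lebesgue_measure R).-integrable I01
                 (fun s => (dotS (f s) (f s))%:E)]].

Definition dotH (R : realType) (D : nat) (f g : R -> 'M[R]_D) : R :=
  \int[lebesgue_measure]_(s in I01) dotS (f s) (g s).

Definition normH (R : realType) (D : nat) (f : R -> 'M[R]_D) : R :=
  Num.sqrt (dotH f f).

(* All representatives of the classes in the cone C: the regular function m
   (right-continuous with left limits, increasing, positive semidefinite) is
   only one representative of the class of f. *)
Definition coneC (R : realType) (D : nat) : set (R -> 'M[R]_D) :=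
  [set f | L2S f /\ exists m : R -> 'M[R]_D,
    [/\ L2S m,
        forall s, I01 s -> psdS (m s),
        (forall t, I01 t -> m s @[s --> t^'+] --> m t) /\
        (forall t : R, 0 < t < 1 -> exists l : 'M[R]_D, m s @[s --> t^'-] --> l),
        forall s t, I01 s -> I01 t -> s <= t -> psdS (m t - m s) &
        {ae @lebesgue_measure R, forall s, I01 s -> f s = m s}]].

Definition coneCdual (R : realType) (D : nat) : set (R -> 'M[R]_D) :=
  [set f | L2S f /\ forall mu, coneC mu -> 0 <= dotH f mu].

(* Such a g is automatically constant on almost-everywhere classes: if
   mu = mu' a.e. then both mu - mu' and mu' - mu are in the dual cone. *)
Definition Cdual_increasing (R : realType) (D : nat)
    (g : (R -> 'M[R]_D) -> R) : Prop :=
  forall mu mu', coneC mu -> coneC mu' ->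
    coneCdual (fun s => mu s - mu' s) -> g mu' <= g mu.

(* Norm continuity on L^2. It also forces h to be constant on
   almost-everywhere classes, so that h is a function on H. *)
Definition L2_continuous (R : realType) (D : nat)
    (h : (R -> 'M[R]_D) -> R) : Prop :=
  forall f, L2S f -> forall e : R, 0 < e -> exists2 d : R, 0 < d &
    forall g, L2S g -> normH (fun s => g s - f s) < d -> `|h g - h f| < e.

(* pts is (t_1, ..., t_n); the last clause forces n >= 1. *)
Record partition01 (R : realType) := Partition {
  pts :> seq R;
  ptsP : path <%R 0 pts && (last 0 pts == 1) }.

(* For k : 'I_n, counted from 0, tpred j k = t_k and tnext j k = t_(k+1) in
   the numbering t_0 = 0 < t_1 < ... < t_n = 1. *)
Definition tpred (R : realType) (j : partition01 R) (k : 'I_(size j)) : R :=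
  nth 0 (0 :: pts j) k.
Definition tnext (R : realType) (j : partition01 R) (k : 'I_(size j)) : R :=
  nth 0 (pts j) k.
Definition cell (R : realType) (j : partition01 R) (k : 'I_(size j)) : set R :=
  `[tpred k, tnext k[%classic.

Definition refines (R : realType) (j i : partition01 R) : Prop :=
  {subset pts i <= pts j}.

Definition directed (R : realType) (J : set (partition01 R)) : Prop :=
  forall j1 j2, J j1 -> J j2 ->
    exists2 j, J j & refines j j1 /\ refines j j2.

Definition generating (R : realType) (J : set (partition01 R)) : Prop :=
  directed J /\
  <<s I01, \bigcup_(j in J) <<s I01, range (@cell R j)>> >>
    = [set A : set R | measurable A /\ A `<=` I01].

Definition net_cvg (R : realType) (T : topologicalType) (J : set (partition01 R))
    (x_ : partition01 R -> T) (x : T) : Prop :=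
  forall N, nbhs x N -> exists2 jN, J jN &
    forall j, J j -> refines j jN -> N (x_ j).

Definition dotHj (R : realType) (D : nat) (j : partition01 R)
    (x y : 'I_(size j) -> 'M[R]_D) : R :=
  \sum_k (tnext k - tpred k) * dotS (x k) (y k).

Definition coneCj (R : realType) (D : nat) (j : partition01 R) :
    set ('I_(size j) -> 'M[R]_D) :=
  [set x | (forall k, psdS (x k)) /\
           forall k l : 'I_(size j), (k <= l)%N -> psdS (x l - x k)].

Definition projj (R : realType) (D : nat) (j : partition01 R) (f : R -> 'M[R]_D) :
    'I_(size j) -> 'M[R]_D :=
  fun k => (tnext k - tpred k)^-1 *:
    \matrix_(a, b) \int[lebesgue_measure]_(s in cell k) f s a b.

Definition liftj (R : realType) (D : nat) (j : partition01 R)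
    (x : 'I_(size j) -> 'M[R]_D) : R -> 'M[R]_D :=
  fun s => \sum_k \1_(cell k) s *: x k.

Arguments coneC R D : clear implicits.
Arguments coneCj {R} D j.
Arguments projj {R D} j f.

(* Main.v *)
Require Import Defs.
From HB Require Import structures.
From mathcomp Require Import all_boot all_order all_algebra.
From mathcomp Require Import all_classical all_reals all_analysis.
From mathcomp Require Import measurable_realfun ring lra.

Set Implicit Arguments.
Unset Strict Implicit.
Unset Printing Implicit Defensive.

Import Order.TTheory GRing.Theory Num.Theory.
Import numFieldNormedType.Exports.

Local Open Scope classical_set_scope.
Local Open Scope ring_scope.

(* Write P_j for the averaging operator l_j p_j. It is self-adjoint, preserves the
   cone C, and nu - P_j nu lies in the dual cone, because on each cell
   (nu(s) - nu(r)).(rho(s) - rho(r)) >= 0 for increasing nu, rho. So psi does not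
   increase under P_j, and f_j(t, p_j mu) is exactly the supremum defining
   f(t, mu) restricted to the step functions rho in l_j C^j; hence lim f_j <= f.
   Conversely, inserting z = p_j rho for rho in C changes the expression by
   t (H(rho) - H(P_j rho)) + <mu - P_j mu, rho>, and both terms vanish along the
   net since P_j rho -> rho and P_j mu -> mu in H.

   For this convergence no martingale theorem is needed: a generating collection has
   partitions of arbitrarily small mesh, and for increasing m the function
   S = |m|^2 is nondecreasing, so that with mesh at most d
     |m - P_j m|^2 = |m|^2 - |p_j m|^2 <= int S - sum_k (t_k - t_(k-1)) S(t_(k-1))
   is at most the integral of S over [1 - d, 1). *)

(** * Positive semidefinite matrices *)

Section psd.
Context {R : realType} {D : nat}.
Implicit Types (a b c : 'M[R]_D) (u v w : 'cV[R]_D).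

Definition bilS a u v : R := (u^T *m a *m v) 0 0.

Lemma bilSDl a u v w : bilS a (u + v) w = bilS a u w + bilS a v w.
Proof. by rewrite /bilS linearD/= !mulmxDl mxE. Qed.

Lemma bilSDr a u v w : bilS a u (v + w) = bilS a u v + bilS a u w.
Proof. by rewrite /bilS mulmxDr mxE. Qed.

Lemma bilSZl a x u v : bilS a (x *: u) v = x * bilS a u v.
Proof. by rewrite /bilS linearZ/= -!scalemxAl mxE. Qed.

Lemma bilSZr a x u v : bilS a u (x *: v) = x * bilS a u v.
Proof. by rewrite /bilS -scalemxAr mxE. Qed.

Lemma bilSC a u v : symS a -> bilS a u v = bilS a v u.
Proof.
move=> sa; rewrite /bilS.
have -> : u^T *m a *m v = (v^T *m a *m u)^T.
  by rewrite !trmx_mul trmxK sa mulmxA.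
by rewrite mxE.
Qed.

Lemma bilSBl a b u v : bilS (a - b) u v = bilS a u v - bilS b u v.
Proof. by rewrite /bilS mulmxBr mulmxBl !mxE. Qed.

Lemma bilS_sum a u v : bilS a u v = \sum_i \sum_k u i 0 * v k 0 * a i k.
Proof.
rewrite /bilS mxE exchange_big/=; apply: eq_bigr => k _.
rewrite mxE mulr_suml; apply: eq_bigr => i _; rewrite mxE; ring.
Qed.

Lemma bilS_delta a i k : bilS a (delta_mx i 0) (delta_mx k 0) = a i k.
Proof.
by rewrite /bilS trmx_delta -rowE -colE !mxE.
Qed.

Lemma dotSE a b : dotS a b = \sum_i \sum_k a i k * b k i.
Proof. by apply: eq_bigr => i _; rewrite mxE. Qed.

Lemma dotSC a b : dotS a b = dotS b a.
Proof. exact: mxtrace_mulC. Qed.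

Lemma dotSDl a b c : dotS (a + b) c = dotS a c + dotS b c.
Proof. by rewrite /dotS mulmxDl linearD. Qed.

Lemma dotSBl a b c : dotS (a - b) c = dotS a c - dotS b c.
Proof. by rewrite /dotS mulmxBl linearB. Qed.

Lemma dotSBr a b c : dotS a (b - c) = dotS a b - dotS a c.
Proof. by rewrite /dotS mulmxBr linearB. Qed.

Lemma dotSZl x a b : dotS (x *: a) b = x * dotS a b.
Proof. by rewrite /dotS -scalemxAl linearZ. Qed.

Lemma dotSZr x a b : dotS a (x *: b) = x * dotS a b.
Proof. by rewrite dotSC dotSZl dotSC. Qed.

Lemma dotS_rank1 u b : dotS (u *m u^T) b = bilS b u u.
Proof. by rewrite /dotS -mulmxA mxtrace_mulC trace_mx11. Qed.

Lemma bilS_rank1 u v : bilS (u *m u^T) v v = (u^T *m v) 0 0 ^+ 2.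
Proof.
rewrite /bilS mulmxA -mulmxA mxE big_ord1 expr2; congr (_ * _).
by rewrite -[in LHS](trmxK u) -trmx_mul mxE.
Qed.

Lemma symSB a b : symS a -> symS b -> symS (a - b).
Proof. by move=> sa sb; rewrite /symS/= linearB/= sa sb. Qed.

Lemma psdSD a b : psdS a -> psdS b -> psdS (a + b).
Proof.
move=> [sa pa] [sb pb]; split=> [|v]; first by rewrite /symS/= linearD/= sa sb.
by rewrite mulmxDr mulmxDl mxE addr_ge0.
Qed.

Lemma psdS0 : psdS (0 : 'M[R]_D).
Proof.
by split=> [|v]; [rewrite /symS/= trmx0 | rewrite mulmx0 mul0mx mxE].
Qed.

(** Cauchy-Schwarz for the form of [a], by evaluating it at [v] minus its [a]-orthogonal projection
    onto the line of [u]. *)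
Lemma psdS_cauchy a u v : psdS a -> 0 < bilS a u u ->
  bilS a u v ^+ 2 / bilS a u u <= bilS a v v.
Proof.
move=> [sa pa] u0.
have := pa (v + (- (bilS a u v / bilS a u u)) *: u).
rewrite -/(bilS _ _ _) !(bilSDl, bilSDr, bilSZl, bilSZr) (bilSC v u sa).
move=> h; rewrite -subr_ge0; apply: le_trans h _.
by rewrite le_eqVlt; apply/orP; left; apply/eqP; field; rewrite gt_eqF.
Qed.

(* Subtracting [(a e_i)(a e_i)^T / a_ii] keeps [a] semidefinite
   and kills one more diagonal entry. *)
Lemma psdS_dot_ge0 a b : psdS a -> psdS b -> 0 <= dotS a b.
Proof.
move=> pa pb; have [n] := ubnP #|[set i | a i i != 0]|%SET.
elim: n => // n IHn in a pa *; rewrite ltnS => an.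
have [i|a0] := pickP (fun i => a i i != 0); last first.
  suff -> : a = 0 by rewrite /dotS mul0mx linear0.
  apply/matrixP => k l; rewrite mxE.
  have d0 j : a j j = 0 by apply/eqP; have /negbFE := a0 j.
  (* With a zero diagonal, the form at e_k - a_kl e_l equals -2 a_kl^2, so semidefiniteness forces
     a_kl = 0. *)
  have := pa.2 (delta_mx k 0 - (a k l) *: delta_mx l 0).
  rewrite -/(bilS _ _ _) -scaleNr !(bilSDl, bilSDr, bilSZl, bilSZr) !bilS_delta.
  have -> : a l k = a k l by rewrite -[in LHS]pa.1 mxE.
  rewrite !d0 !mulr0 addr0 add0r -mulrDl -opprD mulNr oppr_ge0 => h.
  apply/eqP; rewrite -sqrf_eq0 eq_le sqr_ge0 andbT.
  by rewrite expr2; lra.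
move=> ai; have ai0 : 0 < a i i.
  by rewrite lt0r ai -(bilS_delta a i i); exact: pa.2.
pose u : 'cV[R]_D := a *m delta_mx i 0.
have uE v : bilS a (delta_mx i 0) v = (u^T *m v) 0 0.
  by rewrite /bilS /u trmx_mul pa.1.
pose a' := a - (a i i)^-1 *: (u *m u^T).
have bE v : bilS a' v v = bilS a v v - bilS a (delta_mx i 0) v ^+ 2 / a i i.
  rewrite /a' {1}/bilS mulmxBr mulmxBl mxE; congr (_ + _).
  by rewrite mxE -scalemxAr -scalemxAl mxE mulrC -/(bilS _ _ _) bilS_rank1 uE.
have pa' : psdS a'.
  split.
    rewrite /symS/= /a' linearB/= linearZ/= trmx_mul trmxK.
    by congr (_ - _); exact: pa.1.
  move=> v; rewrite -/(bilS _ _ _) bE subr_ge0.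
  by rewrite -(bilS_delta a i i) psdS_cauchy// bilS_delta.
have aE : a = a' + (a i i)^-1 *: (u *m u^T) by rewrite subrK.
rewrite aE dotSDl dotSZl dotS_rank1 addr_ge0//.
  apply: IHn => //; apply: leq_trans an; apply: proper_card.
  apply/properP; split.
    (* No new nonzero diagonal entry appears: if a_kk = 0 then a'_kk = -a_ik^2 / a_ii, and
       semidefiniteness of [a'] makes it vanish. *)
    apply/fintype.subsetP => k; rewrite !inE; apply: contra => /eqP ak.
    rewrite -(bilS_delta a' k k) bE !bilS_delta ak sub0r oppr_eq0.
    have := pa'.2 (delta_mx k 0); rewrite -/(bilS _ _ _) bE !bilS_delta ak.
    rewrite sub0r oppr_ge0 => h; rewrite eq_le h/=.
    by rewrite mulr_ge0 ?sqr_ge0 ?invr_ge0 ?ltW.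
  exists i; rewrite !inE//.
  rewrite -(bilS_delta a' i i) bE !bilS_delta negbK.
  by rewrite expr2 mulfK ?subrr// gt_eqF.
by rewrite mulr_ge0 ?(pb.2 u)// invr_ge0 ltW.
Qed.

(** The difference of the two sides is (b - a).(b + a), a product of two semidefinite matrices. *)
Lemma le_psdS_dot a b : psdS a -> psdS (b - a) -> dotS a a <= dotS b b.
Proof.
move=> pa pba.
have pb : psdS b by rewrite -(subrK a b); exact: psdSD.
rewrite -subr_ge0.
have -> : dotS b b - dotS a a = dotS (b - a) (b + a).
  by rewrite dotSBl [dotS b (b + a)]dotSC [dotS a (b + a)]dotSC !dotSDl
             [dotS a b]dotSC; ring.
by apply: psdS_dot_ge0 => //; exact: psdSD.
Qed.

End psd.

(** * Square-integrable functions on [[0, 1)] *)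

Section square_integrable.
Context {R : realType}.
Local Notation mu := (@lebesgue_measure R).
Implicit Types (f g : R -> R) (A B : set R).

Lemma measurable_I01 : measurable (@I01 R).
Proof. exact: measurable_itv. Qed.
#[local] Hint Resolve measurable_I01 : core.

Local Notation itg A f := (mu.-integrable A (EFin \o f)).

Lemma eq_itg A f g : measurable A -> (forall s, A s -> f s = g s) ->
  itg A f -> itg A g.
Proof.
move=> mA fg; apply: eq_integrable => // s; rewrite inE => As /=.
by rewrite fg.
Qed.

Lemma itgD A f g : measurable A -> itg A f -> itg A g ->
  itg A (fun s => f s + g s).
Proof. by move=> mA fi gi; exact: (@integrableD _ _ R mu A mA _ _ fi gi). Qed.

Lemma itgB A f g : measurable A -> itg A f -> itg A g ->
  itg A (fun s => f s - g s).
Proof. by move=> mA fi gi; exact: (@integrableB _ _ R mu A mA _ _ fi gi). Qed.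

Lemma itgZ A x f : measurable A -> itg A f -> itg A (fun s => x * f s).
Proof. by move=> mA fi; exact: (@integrableZl _ _ R mu A mA x _ fi). Qed.

Lemma itg_measurable A f : itg A f -> measurable_fun A f.
Proof.
by move=> fi; have /measurable_EFinP := @measurable_int _ _ R mu _ _ fi.
Qed.

Lemma ae_imp (P Q : R -> Prop) : (forall s, P s -> Q s) ->
  {ae mu, forall s, P s} -> {ae mu, forall s, Q s}.
Proof.
move=> PQ [N [mN N0 PN]]; exists N; split=> // s /= nQ.
by apply: PN => /= Ps; exact/nQ/PQ.
Qed.

Lemma ae_eq_Rint A f g : measurable A -> itg A f -> itg A g ->
  {ae mu, forall s, A s -> f s = g s} ->
  \int[mu]_(s in A) f s = \int[mu]_(s in A) g s.
Proof.
move=> mA /itg_measurable mf /itg_measurable mg fg; congr fine.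
apply: (@ae_eq_integral _ _ R mu A _ _ mA); [exact/measurable_EFinP..|].
by apply: ae_imp fg => s fg As; rewrite fg.
Qed.

Lemma RintB A f g : measurable A -> itg A f -> itg A g ->
  \int[mu]_(s in A) (f s - g s) = \int[mu]_(s in A) f s - \int[mu]_(s in A) g s.
Proof. by move=> mA fi gi; exact: (@RintegralB _ _ R mu A _ _ mA fi gi). Qed.

Lemma RintD A f g : measurable A -> itg A f -> itg A g ->
  \int[mu]_(s in A) (f s + g s) = \int[mu]_(s in A) f s + \int[mu]_(s in A) g s.
Proof. by move=> mA fi gi; exact: (@RintegralD _ _ R mu A _ _ mA fi gi). Qed.

Lemma RintZ A x f : measurable A -> itg A f ->
  \int[mu]_(s in A) (x * f s) = x * \int[mu]_(s in A) f s.
Proof. by move=> mA fi; exact: (@RintegralZl _ _ R mu A _ x mA fi). Qed.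

Lemma le_Rint A f g : measurable A -> itg A f -> itg A g ->
  (forall s, A s -> f s <= g s) ->
  \int[mu]_(s in A) f s <= \int[mu]_(s in A) g s.
Proof. by move=> mA fi gi; exact: (@le_Rintegral _ _ R mu A _ _ mA fi gi). Qed.

Lemma itg_sum A (I : Type) (r : seq I) (F : I -> R -> R) : measurable A ->
  (forall i, itg A (F i)) -> itg A (fun s => \sum_(i <- r) F i s).
Proof.
move=> mA Fi.
have -> : EFin \o (fun s => \sum_(i <- r) F i s) =
    (fun s => \sum_(i <- r) (EFin \o F i) s)%E.
  by apply/funext => s /=; rewrite sumEFin.
by apply: integrable_sum.
Qed.

Lemma Rintegral_sum A (I : Type) (r : seq I) (F : I -> R -> R) : measurable A ->
  (forall i, itg A (F i)) ->
  \int[mu]_(s in A) (\sum_(i <- r) F i s) = \sum_(i <- r) \int[mu]_(s in A) F i s.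
Proof.
move=> mA Fi; elim: r => [|i r IHr].
  under eq_Rintegral do rewrite big_nil.
  by rewrite Rintegral_cst// mul0r big_nil.
under eq_Rintegral do rewrite big_cons.
by rewrite RintegralD ?IHr ?big_cons//; exact: itg_sum.
Qed.

Lemma itgS A B f : measurable A -> measurable B -> A `<=` B -> itg B f -> itg A f.
Proof. by move=> mA mB AB; exact: integrableS. Qed.

Lemma Rintegral_indic_mul A B f : A `<=` B ->
  \int[mu]_(s in B) (\1_A s * f s) = \int[mu]_(s in A) f s.
Proof.
move=> AB; rewrite -[in RHS](setIidr AB) Rintegral_mkcondr.
apply: eq_Rintegral => s _; rewrite patchE indicE.
by case: ifP => _; rewrite (mul1r, mul0r).
Qed.

Lemma itg_indic_mul A B f : measurable A -> measurable B -> itg B f ->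
  itg B (fun s => \1_A s * f s).
Proof.
move=> mA mB fi; apply: (@le_integrable _ _ R mu B mB _ _ _ _ fi).
  apply/measurable_EFinP/measurable_funM; first exact: measurable_indic.
  by move/measurable_int : fi => /measurable_EFinP.
move=> s _; rewrite lee_fin normrM ler_piMl// indicE.
by case: (s \in A); rewrite ?normr1 ?normr0.
Qed.

Lemma itg_cst (x : R) : itg I01 (cst x).
Proof.
apply/integrableP; split; first exact/measurable_EFinP.
rewrite /=; under eq_integral do rewrite /=.
by rewrite integral_cst//= lebesgue_measure_itv/= lte_fin ltr01 -EFinB -EFinM ltry.
Qed.

Definition sqi f := measurable_fun I01 f /\ itg I01 (fun s => f s ^+ 2).

(** Domination by |f g| <= f^2 + g^2. *)
Lemma sqiM f g : sqi f -> sqi g -> itg I01 (fun s => f s * g s).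
Proof.
move=> [mf fi] [mg gi].
apply: (@le_integrable _ _ R mu I01 measurable_I01 _ _ _ _
  (itgD measurable_I01 fi gi)).
  exact/measurable_EFinP/measurable_funM.
move=> s _; rewrite lee_fin [leRHS]ger0_norm ?addr_ge0 ?sqr_ge0//.
rewrite ler_norml; apply/andP; split.
  rewrite lerNl -subr_ge0.
  have := sqr_ge0 (f s + g s); have := sqr_ge0 (f s); have := sqr_ge0 (g s).
  by rewrite !expr2; lra.
have := sqr_ge0 (f s - g s); have := sqr_ge0 (f s); have := sqr_ge0 (g s).
by rewrite !expr2; lra.
Qed.

Lemma sqi_bounded f (M : R) : measurable_fun I01 f ->
  (forall s, I01 s -> `|f s| <= M) -> sqi f.
Proof.
move=> mf fM; split=> //.
apply: (@le_integrable _ _ R mu I01 measurable_I01 _ _ _ _ (itg_cst (M ^+ 2))).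
  exact/measurable_EFinP/measurable_funX.
move=> s Is; rewrite lee_fin !ger0_norm ?sqr_ge0//.
by rewrite -(ger0_norm (sqr_ge0 (f s))) normrX lerXn2r// ?nnegrE ?fM//
  (le_trans _ (fM _ Is)).
Qed.

Lemma sqi_cst (x : R) : sqi (cst x).
Proof. by apply: (@sqi_bounded _ `|x|) => //; exact: measurable_cst. Qed.

Lemma sqi_itg f : sqi f -> itg I01 f.
Proof.
move=> sf; apply: eq_itg (sqiM (sqi_cst 1) sf) => // s _.
by rewrite mul1r.
Qed.

Lemma sqiB f g : sqi f -> sqi g -> sqi (fun s => f s - g s).
Proof.
move=> sf sg; split; first exact: measurable_funB sf.1 sg.1.
pose h s := f s * f s - f s * g s - (g s * f s - g s * g s).
apply: (@eq_itg _ h) => // [s _|]; first by rewrite /h; ring.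
by apply: itgB => //; apply: itgB => //; exact: sqiM.
Qed.

End square_integrable.

#[local] Hint Resolve measurable_I01 : core.

(** * Matrix-valued square-integrable functions, their pairings and integrals *)

Section L2S_theory.
Context {R : realType} {D : nat}.
Local Notation mu := (@lebesgue_measure R).
Local Notation itg A f := (mu.-integrable A (EFin \o f)).
Implicit Types (f g h : R -> 'M[R]_D) (A : set R).

(** By symmetry the right side is the sum of the squares of all entries. This passes square
    integrability from matrices to entries. *)
Lemma dotS_sym_ge (a : 'M[R]_D) i k : symS a -> a i k ^+ 2 <= dotS a a.
Proof.
move=> sa; rewrite dotSE (bigD1 i)//= (bigD1 k)//= -addrA.
have sq l j : a l j * a j l = a l j ^+ 2 by rewrite -[in a j l]sa mxE expr2.
by rewrite sq lerDl addr_ge0// !sumr_ge0// => j _; rewrite ?sumr_ge0// => *;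
   rewrite sq sqr_ge0.
Qed.

Lemma dotS_ge0 (a : 'M[R]_D) : symS a -> 0 <= dotS a a.
Proof.
move=> sa; rewrite dotSE sumr_ge0// => i _; rewrite sumr_ge0// => k _.
by rewrite -[in a k i]sa mxE -expr2 sqr_ge0.
Qed.

Lemma L2S_sqi f : L2S f -> forall i k, sqi (fun s => f s i k).
Proof.
move=> [sf mf fi] i k; split; first exact: mf.
apply: (@le_integrable _ _ R mu I01 measurable_I01 _ _ _ _ fi).
  by apply/measurable_EFinP; apply: measurable_funX; exact: mf.
move=> s Is; rewrite lee_fin !ger0_norm ?sqr_ge0 ?dotS_ge0//; last exact: sf.
by apply: dotS_sym_ge; exact: sf.
Qed.

Lemma itg_dotS f g : (forall i k, sqi (fun s => f s i k)) ->
  (forall i k, sqi (fun s => g s i k)) ->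
  itg I01 (fun s => dotS (f s) (g s)).
Proof.
move=> sf sg; under eq_fun do rewrite dotSE.
by apply: itg_sum => // i; apply: itg_sum => // k; exact: sqiM.
Qed.

Lemma itg_L2S f g : L2S f -> L2S g -> itg I01 (fun s => dotS (f s) (g s)).
Proof. by move=> /L2S_sqi sf /L2S_sqi sg; exact: itg_dotS. Qed.

Lemma sqi_L2S f : (forall s, I01 s -> symS (f s)) ->
  (forall i k, sqi (fun s => f s i k)) -> L2S f.
Proof.
by move=> yf sf; split=> // [i k|]; [exact: (sf i k).1|exact: itg_dotS].
Qed.

Lemma L2SB f g : L2S f -> L2S g -> L2S (fun s => f s - g s).
Proof.
move=> Lf Lg; apply: sqi_L2S => [s Is|i k].
  by case: Lf Lg => sf _ _ [sg _ _]; apply: symSB; [exact: sf|exact: sg].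
under eq_fun do rewrite !mxE.
by apply: sqiB; exact: L2S_sqi.
Qed.

Lemma dotHC f g : dotH f g = dotH g f.
Proof. by apply: eq_Rintegral => s _; rewrite dotSC. Qed.

Lemma dotHBl f g h : L2S f -> L2S g -> L2S h ->
  dotH (fun s => f s - g s) h = dotH f h - dotH g h.
Proof.
move=> Lf Lg Lh; rewrite /dotH; under eq_Rintegral do rewrite dotSBl.
by rewrite (RintB measurable_I01 (itg_L2S Lf Lh) (itg_L2S Lg Lh)).
Qed.

Lemma dotHBr f g h : L2S f -> L2S g -> L2S h ->
  dotH h (fun s => f s - g s) = dotH h f - dotH h g.
Proof. by move=> *; rewrite dotHC dotHBl// ![dotH h _]dotHC. Qed.

Lemma dotH_ge0 f : L2S f -> 0 <= dotH f f.
Proof. by move=> [sf _ _]; apply: Rintegral_ge0 => s Is; exact/dotS_ge0/sf. Qed.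

Lemma eq_dotHl f g h : L2S f -> L2S g -> L2S h ->
  {ae mu, forall s, I01 s -> f s = g s} -> dotH f h = dotH g h.
Proof.
move=> Lf Lg Lh fg.
apply: (ae_eq_Rint measurable_I01 (itg_L2S Lf Lh) (itg_L2S Lg Lh)).
by apply: ae_imp fg => s fg Is; rewrite fg.
Qed.

Definition intM A f : 'M[R]_D := \matrix_(a, b) \int[mu]_(s in A) f s a b.

Lemma dotS_intM A (x : 'M[R]_D) f : measurable A -> A `<=` I01 -> L2S f ->
  dotS x (intM A f) = \int[mu]_(s in A) dotS x (f s).
Proof.
move=> mA AI Lf.
have fi i k : itg A (fun s => f s i k).
  exact: (itgS mA measurable_I01 AI (sqi_itg (L2S_sqi Lf i k))).
under eq_Rintegral do rewrite dotSE.
rewrite dotSE Rintegral_sum//; last first.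
  by move=> i; apply: itg_sum => // k; exact: itgZ.
apply: eq_bigr => i _; rewrite Rintegral_sum//; last by move=> k; exact: itgZ.
by apply: eq_bigr => k _; rewrite mxE RintZ.
Qed.

(** Reduces order relations between averaged matrices to inequalities between scalar integrals. *)
Lemma bilS_intM A f u v : measurable A -> A `<=` I01 -> L2S f ->
  bilS (intM A f) u v = \int[mu]_(s in A) bilS (f s) u v.
Proof.
move=> mA AI Lf.
have fi i k : itg A (fun s => f s i k).
  exact: (itgS mA measurable_I01 AI (sqi_itg (L2S_sqi Lf i k))).
under eq_Rintegral do rewrite bilS_sum.
rewrite bilS_sum Rintegral_sum//; last first.
  by move=> i; apply: itg_sum => // k; exact: itgZ.
apply: eq_bigr => i _; rewrite Rintegral_sum//; last by move=> k; exact: itgZ.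
by apply: eq_bigr => k _; rewrite mxE RintZ.
Qed.

Lemma itg_bilS f u v : L2S f -> itg I01 (fun s => bilS (f s) u v).
Proof.
move=> Lf; under eq_fun do rewrite bilS_sum.
apply: itg_sum => // i; apply: itg_sum => // k; apply: itgZ => //.
exact/sqi_itg/L2S_sqi.
Qed.

Lemma symS_intM A f : A `<=` I01 -> L2S f -> symS (intM A f).
Proof.
move=> AI [sf _ _]; apply/matrixP => i k; rewrite !mxE.
by apply: eq_Rintegral => s; rewrite inE => /AI/sf fT; rewrite -[in LHS]fT mxE.
Qed.

Lemma eq_intM A f g : measurable A -> A `<=` I01 -> L2S f -> L2S g ->
  {ae mu, forall s, I01 s -> f s = g s} -> intM A f = intM A g.
Proof.
move=> mA AI Lf Lg fg; apply/matrixP => i k; rewrite !mxE.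
have hi h : L2S h -> itg A (fun s => h s i k).
  by move=> Lh; exact: (itgS mA measurable_I01 AI (sqi_itg (L2S_sqi Lh i k))).
apply: (ae_eq_Rint mA (hi _ Lf) (hi _ Lg)).
by apply: ae_imp fg => s fg /AI Is; rewrite fg.
Qed.

End L2S_theory.

(** * Partitions and projections *)

Section partitions.
Context {R : realType} (j : partition01 R).
Implicit Types (k l : 'I_(size j)) (s : R).

Lemma pts_sorted : sorted <%R (0 :: pts j).
Proof. by have /andP[] := ptsP j. Qed.

Lemma pts_last : last 0 (pts j) = 1.
Proof. by have /andP[_ /eqP] := ptsP j. Qed.

Lemma pts_le (a b : nat) : (a <= b <= size j)%N ->
  nth 0 (0 :: pts j) a <= nth 0 (0 :: pts j) b.
Proof.
move=> /andP[ab bj].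
apply: (sorted_leq_nth (@le_trans _ R) (@lexx _ R) 0 _) => //.
- by apply: sub_sorted pts_sorted => x y; exact: ltW.
- by rewrite inE/= ltnS (leq_trans ab).
Qed.

Lemma lt_tpred_tnext k : tpred k < tnext k.
Proof.
have := sorted_ltn_nth lt_trans 0 pts_sorted.
by move=> /(_ k k.+1); rewrite !inE/= !ltnS; apply => //; exact: ltnW.
Qed.

Lemma tnext_le_tpred k l : (k < l)%N -> tnext k <= tpred l.
Proof.
by move=> kl; apply: (@pts_le k.+1 l); rewrite kl/= ltnW.
Qed.

Lemma tpred_ge0 k : 0 <= tpred k.
Proof.
by apply: (@pts_le 0 k); rewrite /= ltnW.
Qed.

Lemma tnext_le1 k : tnext k <= 1.
Proof.
rewrite -pts_last -[leRHS](nth_last 0 (0 :: pts j)).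
by apply: (@pts_le k.+1 (size j)); rewrite leqnn andbT.
Qed.

Lemma cellE k s : cell k s <-> tpred k <= s < tnext k.
Proof. by rewrite /cell/= in_itv. Qed.

Lemma cell_tpred k : cell k (tpred k).
Proof. by rewrite cellE lexx lt_tpred_tnext. Qed.

Lemma cell_sub k : cell k `<=` I01.
Proof.
move=> s /cellE/andP[ks sk]; rewrite /I01/= in_itv/=.
by rewrite (le_trans (tpred_ge0 k))// (lt_le_trans sk)// tnext_le1.
Qed.

Lemma cell_cover s : I01 s -> exists k, cell k s.
Proof.
rewrite /I01/= in_itv/= => /andP[s0 s1].
have hs : has (fun x => s < x) (pts j).
  apply/hasP; exists 1 => //; rewrite -pts_last.
  have := pts_last; case: (pts j) => [/= /eqP|x p _]; last by rewrite /= mem_last.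
  by rewrite eq_sym oner_eq0.
(* The cell is the one ending at the first partition point above [s]; minimality puts its left end
   at or below [s]. *)
have ks := hs; rewrite has_find in ks.
exists (Ordinal ks); apply/cellE; rewrite /tpred /tnext/= nth_find// andbT.
move: ks; case E : (find _ _) => [//|k] ks /=.
by rewrite leNgt (@before_find _ 0 (fun x => s < x))// E.
Qed.

Lemma cell_lt k l s r : (k < l)%N -> cell k s -> cell l r -> s < r.
Proof.
move=> kl /cellE/andP[_ sk] /cellE/andP[lr _].
by rewrite (lt_le_trans sk)// (le_trans (tnext_le_tpred kl)).
Qed.

Lemma cell_inj k l s : cell k s -> cell l s -> k = l.
Proof.
move=> ks ls; have [kl|lk|] := ltngtP k l; last exact: ord_inj.
- by have := cell_lt kl ks ls; rewrite ltxx.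
- by have := cell_lt lk ls ks; rewrite ltxx.
Qed.

Lemma measurable_cell k : measurable (cell k).
Proof. exact: measurable_itv. Qed.

Lemma Rint_cst_cell k (x : R) :
  \int[lebesgue_measure]_(s in cell k) x = x * (tnext k - tpred k).
Proof.
rewrite Rintegral_cst; last exact: measurable_cell.
by rewrite /cell/= lebesgue_measure_itv/= lte_fin lt_tpred_tnext.
Qed.

Lemma cell_indic k l s : cell k s -> \1_(cell l) s = (l == k)%:R :> R.
Proof.
move=> ks; rewrite indicE; case: eqP => [->|lk]; first by rewrite mem_set.
by rewrite memNset// => ls; apply: lk; exact: cell_inj ls ks.
Qed.

Lemma liftjE D (x : 'I_(size j) -> 'M[R]_D) k s : cell k s -> liftj x s = x k.
Proof.
move=> ks; rewrite /liftj (bigD1 k)//= big1 => [|l /negbTE lk].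
  by rewrite (cell_indic _ ks) eqxx scale1r addr0.
by rewrite (cell_indic _ ks) lk scale0r.
Qed.

End partitions.

#[local] Hint Resolve measurable_cell : core.

(** * Averaging over cells and its action on the cones *)

Section projection.
Context {R : realType} {D : nat}.
Local Notation mu := (@lebesgue_measure R).
Local Notation itg A f := (mu.-integrable A (EFin \o f)).
Implicit Types (f g m : R -> 'M[R]_D) (j : partition01 R).

Lemma L2S_liftj j (x : 'I_(size j) -> 'M[R]_D) : (forall k, symS (x k)) ->
  L2S (liftj x).
Proof.
move=> sx; apply: sqi_L2S => [s /(cell_cover j)[k ks]|a b].
  by rewrite (liftjE _ ks); exact: sx.
have E s : liftj x s a b = \sum_k \1_(cell k) s * x k a b.
  by rewrite /liftj summxE; apply: eq_bigr => k _; rewrite mxE.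
under eq_fun do rewrite E.
apply: (@sqi_bounded _ _ (\sum_k `|x k a b|)) => [|s /(cell_cover j)[k ks]].
  apply: measurable_sum => k; apply: measurable_funM; last exact: measurable_cst.
  exact: (measurable_indic (measurable_cell k)).
by rewrite -E (liftjE _ ks) (bigD1 k)//= lerDl sumr_ge0.
Qed.

(** Adjointness of [liftj] and [projj]: the weights of [dotHj] cancel the normalisation of the
    averages. *)
Lemma dotH_liftj j (x : 'I_(size j) -> 'M[R]_D) f : L2S f ->
  (forall k, symS (x k)) -> dotH (liftj x) f = dotHj x (projj j f).
Proof.
move=> Lf sx; rewrite /dotH.
have E s : dotS (liftj x s) (f s) = \sum_k \1_(cell k) s * dotS (x k) (f s).
  rewrite /liftj /dotS mulmx_suml linear_sum; apply: eq_bigr => k _.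
  by rewrite -scalemxAl linearZ.
have xi k : itg I01 (fun s => dotS (x k) (f s)).
  by apply: itg_dotS => *; [exact: sqi_cst|exact: L2S_sqi].
under eq_Rintegral do rewrite E.
rewrite Rintegral_sum//; last by move=> k; exact: itg_indic_mul.
apply: eq_bigr => k _.
rewrite Rintegral_indic_mul; last exact: cell_sub.
rewrite -dotS_intM//; last exact: cell_sub.
rewrite /projj -/(intM _ _) dotSZr mulrA divff ?mul1r//.
by rewrite subr_eq0 gt_eqF// lt_tpred_tnext.
Qed.

Lemma projj_liftj j (x : 'I_(size j) -> 'M[R]_D) : projj j (liftj x) = x.
Proof.
apply/funext => k; apply/matrixP => a b; rewrite !mxE.
rewrite (_ : \int[_]_(s in _) _ = \int[mu]_(s in cell k) x k a b); last first.
  by apply: eq_Rintegral => s; rewrite inE => ks; rewrite (liftjE _ ks).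
rewrite Rint_cst_cell mulrC mulfK//.
by rewrite subr_eq0 gt_eqF// lt_tpred_tnext.
Qed.

Lemma eq_projj j f g : L2S f -> L2S g ->
  {ae mu, forall s, I01 s -> f s = g s} -> projj j f = projj j g.
Proof.
move=> Lf Lg fg; apply/funext => k; rewrite /projj -!/(intM _ _).
by rewrite (eq_intM _ _ Lf Lg fg)//; exact: cell_sub.
Qed.

Lemma symS_projj j f k : L2S f -> symS (projj j f k).
Proof.
move=> Lf; rewrite /symS/= /projj linearZ/= -/(intM _ _).
by congr (_ *: _); apply: symS_intM => //; exact: cell_sub.
Qed.

Lemma bilS_projj j f k u v : L2S f ->
  bilS (projj j f k) u v =
  (tnext k - tpred k)^-1 * \int[mu]_(s in cell k) bilS (f s) u v.
Proof.
move=> Lf; rewrite -bilS_intM//; last exact: cell_sub.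
by rewrite /bilS /projj -scalemxAr -scalemxAl mxE.
Qed.

Lemma itg_cst_cell j (k : 'I_(size j)) (x : R) : itg (cell k) (fun=> x).
Proof.
exact: (itgS (measurable_cell k) (@measurable_I01 R) (@cell_sub _ _ k) (itg_cst x)).
Qed.

Lemma bilS_projj_le j f k v x : L2S f ->
  (forall s, cell k s -> bilS (f s) v v <= x) -> bilS (projj j f k) v v <= x.
Proof.
move=> Lf fx; rewrite bilS_projj//.
rewrite mulrC ler_pdivrMr ?subr_gt0 ?lt_tpred_tnext//.
rewrite -Rint_cst_cell.
apply: le_Rint => //; last exact: itg_cst_cell.
apply: (itgS (measurable_cell k) (@measurable_I01 R) (@cell_sub _ _ k)).
exact: itg_bilS.
Qed.

Lemma bilS_projj_ge j f k v x : L2S f ->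
  (forall s, cell k s -> x <= bilS (f s) v v) -> x <= bilS (projj j f k) v v.
Proof.
move=> Lf fx; rewrite bilS_projj//.
rewrite mulrC ler_pdivlMr ?subr_gt0 ?lt_tpred_tnext//.
rewrite -Rint_cst_cell.
apply: le_Rint => //; first exact: itg_cst_cell.
apply: (itgS (measurable_cell k) (@measurable_I01 R) (@cell_sub _ _ k)).
exact: itg_bilS.
Qed.

Lemma psdSB (a b : 'M[R]_D) : symS a -> symS b ->
  (forall v, bilS b v v <= bilS a v v) -> psdS (a - b).
Proof.
move=> sa sb ab; split=> [|v]; first exact: symSB.
by rewrite -/(bilS _ _ _) bilSBl subr_ge0; exact: ab.
Qed.

Lemma psdSB_le (a b : 'M[R]_D) v : psdS (a - b) -> bilS b v v <= bilS a v v.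
Proof.
move=> [_ /(_ v)].
by rewrite -/(bilS _ _ _) bilSBl subr_ge0.
Qed.

(** Members of [coneC] are arbitrary representatives; pointwise order arguments are made on this
    monotone one and carried over almost everywhere. *)
Definition monoS m := [/\ L2S m, forall s, I01 s -> psdS (m s) &
  forall s t, I01 s -> I01 t -> s <= t -> psdS (m t - m s)].

Lemma coneC_monoS f : coneC R D f -> L2S f /\
  exists2 m, monoS m & {ae mu, forall s, I01 s -> f s = m s}.
Proof. by move=> [Lf [m [? ? _ ? ?]]]; split=> //; exists m. Qed.

(** On a cell an increasing function is smallest at the left end. This serves both for the
    monotonicity of the averages and for bounding |p_j m|^2 from below. *)
Lemma projj_ge_tpred j m k : monoS m -> psdS (projj j m k - m (tpred k)).
Proof.
move=> [Lm pm im].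
have Ik : I01 (tpred k) by apply: cell_sub; exact: cell_tpred.
apply: psdSB; [exact: symS_projj|by case: (pm _ Ik)|move=> v].
apply: bilS_projj_ge => // s ks; apply: psdSB_le; apply: im => //.
  exact: (cell_sub ks).
by move/cellE : ks => /andP[].
Qed.

Lemma coneCj_projj j f : coneC R D f -> coneCj D j (projj j f).
Proof.
move=> /coneC_monoS[Lf [m [Lm pm im] fm]]; rewrite (eq_projj j Lf Lm fm).
have mj k : symS (projj j m k) by exact: symS_projj.
split=> [k|k l].
  split; first exact: mj.
  move=> v; rewrite -/(bilS _ _ _); apply: bilS_projj_ge => // s ks.
  by case: (pm s (cell_sub ks)) => _; exact.
rewrite leq_eqVlt => /predU1P[/ord_inj ->|kl]; first by rewrite subrr; exact: psdS0.
have Il : I01 (tpred l) by apply: cell_sub; exact: cell_tpred.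
(* The value of [m] at the left end of the later cell separates the two averages. *)
apply: psdSB => // v; apply: (@le_trans _ _ (bilS (m (tpred l)) v v)).
  apply: bilS_projj_le => // s ks; apply: psdSB_le; apply: im => //.
    exact: (cell_sub ks).
  by apply/ltW/(cell_lt kl ks); exact: cell_tpred.
by apply: psdSB_le; exact: projj_ge_tpred.
Qed.

(** Version of [cell_cover] with cells closed on the right; it locates the left limit of a step
    function at [t], even when [t] is a partition point. *)
Lemma cell_cover_left j (t : R) : 0 < t <= 1 ->
  exists k : 'I_(size j), tpred k < t <= tnext k.
Proof.
move=> /andP[t0 t1].
have hs : has (fun x => t <= x) (pts j).
  apply/hasP; exists 1 => //; rewrite -(pts_last j).
  have := pts_last j; case: (pts j) => [/= /eqP|x p _]; last by rewrite /= mem_last.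
  by rewrite eq_sym oner_eq0.
have ks := hs; rewrite has_find in ks.
exists (Ordinal ks); rewrite /tpred /tnext/= nth_find// andbT.
move: ks; case E : (find _ _) => [//|k] ks /=.
by rewrite ltNge (@before_find _ 0 (fun x => t <= x))// E.
Qed.

(** The step function is its own regular representative, being constant just to the right and just
    to the left of each point. *)
Lemma coneC_liftj j (x : 'I_(size j) -> 'M[R]_D) : coneCj D j x ->
  coneC R D (liftj x).
Proof.
move=> [px ix].
have Lx : L2S (liftj x) by apply: L2S_liftj => k; case: (px k).
split=> //; exists (liftj x); split=> //.
- by move=> s /(cell_cover j)[k ks]; rewrite (liftjE _ ks).
- split=> [t /(cell_cover j)[k kt]|t /andP[t0 t1]].
    rewrite (liftjE _ kt); apply: cvg_near_cst.
    have /cellE/andP[kt1 tk] := kt; near=> s.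
    apply: liftjE; apply/cellE; apply/andP; split.
      by apply: (le_trans kt1); near: s; exact: nbhs_right_ge.
    by near: s; exact: nbhs_right_lt.
  have [|k /andP[kt tk]] := @cell_cover_left j t; first by rewrite t0 ltW.
  exists (x k); apply: cvg_near_cst; near=> s.
  apply: liftjE; apply/cellE; apply/andP; split.
    by apply/ltW; near: s; exact: nbhs_left_gt.
  by apply: lt_le_trans tk; near: s; exact: nbhs_left_lt.
- move=> s t /(cell_cover j)[k ks] /(cell_cover j)[l lt] st.
  rewrite (liftjE _ ks) (liftjE _ lt); apply: ix; rewrite leqNgt; apply/negP => lk.
  by have := cell_lt lk lt ks; rewrite ltNge st.
- by exists set0; split=> // s /= h; exfalso; exact: h.
Unshelve. all: by end_near. Qed.

(** Chebyshev's integral inequality on each cell: the nonnegative double integral of (m(s) -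
    m(r)).(n(s) - n(r)) equals 2 (L X - M.N), where [L] is the length of the cell and [X], [M], [N]
    are the integrals of m.n, m and n. *)
Lemma dotHj_projj_le j f g : coneC R D f -> coneC R D g ->
  dotHj (projj j f) (projj j g) <= dotH f g.
Proof.
move=> /coneC_monoS[Lf [m mm fm]] /coneC_monoS[Lg [n mn gn]].
have [Lm pm im] := mm; have [Ln pn in_] := mn.
rewrite (eq_projj j Lf Lm fm) (eq_projj j Lg Ln gn).
rewrite (eq_dotHl Lf Lm Lg fm) dotHC (eq_dotHl Lg Ln Lm gn) dotHC.
have mnI s r : I01 s -> I01 r -> 0 <= dotS (m s - m r) (n s - n r).
  (* Exchanging [s] and [r] changes the sign of both increments, so the product is unaffected. *)
  move=> Is Ir; have [sr|/ltW rs] := leP s r; last first.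
    by apply: psdS_dot_ge0; [exact: im|exact: in_].
  rewrite -(opprB (m r)) -(opprB (n r)) /dotS mulNmx mulmxN opprK.
  by apply: psdS_dot_ge0; [exact: im|exact: in_].
have -> : dotH m n = \sum_(k < size j) \int[mu]_(s in cell k) dotS (m s) (n s).
  under [RHS]eq_bigr do rewrite -(Rintegral_indic_mul _ (@cell_sub _ _ _)).
  rewrite -Rintegral_sum//; last first.
    by move=> k; apply: itg_indic_mul => //; exact: itg_L2S.
  apply: eq_Rintegral => s; rewrite inE => /(cell_cover j)[k ks].
  rewrite (bigD1 k)//= big1 => [|l /negbTE lk]; rewrite (cell_indic _ ks).
    by rewrite eqxx mul1r addr0.
  by rewrite lk mul0r.
apply: ler_sum => k _; rewrite /projj -!/(intM _ _) dotSZl dotSZr.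
set L := tnext k - tpred k; have L0 : 0 < L by rewrite subr_gt0 lt_tpred_tnext.
set X := \int[_]_(_ in _) _.
set M := intM _ m; set N := intM _ n.
have itc h : itg I01 h -> itg (cell k) h.
  exact: (itgS (measurable_cell k) (@measurable_I01 R) (@cell_sub _ _ k)).
have mk := measurable_cell k.
have cstI (x : R) : \int[mu]_(s in cell k) x = L * x.
  by rewrite Rint_cst_cell mulrC.
have itmn : itg (cell k) (fun s => dotS (m s) (n s)) by exact/itc/itg_L2S.
have itx (x : 'M[R]_D) h : L2S h -> itg (cell k) (fun s => dotS x (h s)).
  by move=> Lh; apply/itc/itg_dotS => a b; [exact: sqi_cst|exact: L2S_sqi].
have intx (x : 'M[R]_D) h : L2S h ->
    \int[mu]_(s in cell k) dotS x (h s) = dotS x (intM (cell k) h).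
  by move=> Lh; rewrite dotS_intM//; exact: cell_sub.
(* First integration, over [s] with [r] fixed. *)
have inner r : cell k r ->
    0 <= X - dotS N (m r) - dotS M (n r) + L * dotS (m r) (n r).
  move=> kr; pose F s := dotS (m s) (n s) - dotS (m r) (n s)
    - dotS (n r) (m s) + dotS (m r) (n r).
  suff <- : \int[mu]_(s in cell k) F s =
      X - dotS N (m r) - dotS M (n r) + L * dotS (m r) (n r).
    apply: Rintegral_ge0 => s ks.
    have -> : F s = dotS (m s - m r) (n s - n r).
      by rewrite /F dotSBl !dotSBr [dotS (n r) _]dotSC; ring.
    by apply: mnI; [exact: cell_sub ks|exact: cell_sub kr].
  have i1 := itgB mk itmn (itx (m r) n Ln).
  have i2 := itgB mk i1 (itx (n r) m Lm).
  rewrite /F (RintD mk i2 (itg_cst_cell k _)) (RintB mk i1 (itx (n r) m Lm)).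
  rewrite (RintB mk itmn (itx (m r) n Ln)) cstI !intx//.
  by rewrite [dotS N _]dotSC [dotS M _]dotSC.
(* Second integration, over [r]; it yields M.N <= L X, and dividing by [L] gives the claim for the
   averages. *)
have : 0 <= L * X - dotS N M - dotS M N + L * X.
  have -> : L * X - dotS N M - dotS M N + L * X =
      \int[mu]_(r in cell k)
        (X - dotS N (m r) - dotS M (n r) + L * dotS (m r) (n r)).
    have i1 := itgB mk (itg_cst_cell k X) (itx N m Lm).
    have i2 := itgB mk i1 (itx M n Ln).
    rewrite (RintD mk i2 (itgZ L mk itmn)) (RintB mk i1 (itx M n Ln)).
    by rewrite (RintB mk (itg_cst_cell k X) (itx N m Lm)) cstI !intx// RintZ.
  by apply: Rintegral_ge0 => r kr; exact: inner.
rewrite [dotS N M]dotSC => h.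
rewrite mulrA mulfV ?gt_eqF// mul1r mulrC ler_pdivrMr//.
by rewrite mulrC; lra.
Qed.

(** By adjointness the pairing of f - P_j f with [g] is <f, g> - <p_j f, p_j g>. This is the form in
    which [Cdual_increasing] applies to P_j. *)
Lemma projj_dual j f : coneC R D f ->
  coneCdual (fun s => f s - liftj (projj j f) s).
Proof.
move=> Cf; have [Lf _] := Cf.
have sp k : symS (projj j f k) by exact: symS_projj.
have Lp : L2S (liftj (projj j f)) by exact: L2S_liftj.
split=> [|g Cg]; first exact: L2SB.
have [Lg _] := Cg; rewrite dotHBl// subr_ge0 dotH_liftj//.
exact: dotHj_projj_le.
Qed.

End projection.

(** * Approximation along a generating collection *)

Section shift.
Context {R : realType}.
Local Notation mu := (@lebesgue_measure R).
Local Notation itg A f := (mu.-integrable A (EFin \o f)).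
Implicit Types (S : R -> R) (j : partition01 R) (d : R).

Lemma near_gt_ereal (x y : \bar R) : (x < y)%E -> nbhs y [set z | (x < z)%E].
Proof.
by move=> xy; apply: open_nbhs_nbhs; split=> //; exact: open_ereal_gt_ereal.
Qed.

Lemma near_lt_ereal (x y : \bar R) : (y < x)%E -> nbhs y [set z | (z < x)%E].
Proof.
by move=> xy; apply: open_nbhs_nbhs; split=> //; exact: open_ereal_lt_ereal.
Qed.

(** Lebesgue measure is determined by its values on the intervals []a, b]], whose length a
    translation preserves. *)
Lemma lebesgue_measure_shift d (A : set R) : measurable A ->
  pushforward mu ((fun s => s - d) : _ -> measurableTypeR R) A = mu A.
Proof.
have md : measurable_fun [set: measurableTypeR R]
    ((fun s => s - d) : _ -> measurableTypeR R).
  exact: measurable_funB.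
move=> mA; apply/esym/lebesgue_measure_unique => //= _ [[a b]] _ <-.
rewrite /pushforward.
have -> : (fun s => s - d) @^-1` `]a, b]%classic = `]a + d, b + d]%classic.
  by apply/seteqP; split=> s /=; rewrite !in_itv/= ltrBrDr lerBlDr.
rewrite !lebesgue_measure_itv/= !lte_fin ltrD2r; case: ifP => // _.
by rewrite -!EFinB; congr EFin; ring.
Qed.

Lemma EFin_Rint A S : measurable A -> itg A S ->
  (\int[mu]_(x in A) (S x)%:E = (\int[mu]_(x in A) S x)%:E)%E.
Proof.
move=> mA iA; rewrite fineK//.
exact: (@integrable_fin_num _ _ R mu A mA _ iA).
Qed.

(** Monotone convergence along the intervals [F n], which increase to [0, 1). *)
Lemma tail_integral S (e : R) : itg I01 S -> (forall s, I01 s -> 0 <= S s) ->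
  0 < e -> exists2 d, 0 < d < 1 &
  \int[mu]_(s in I01) S s - e < \int[mu]_(s in `[0, 1 - d[) S s.
Proof.
(* The shift to n + 2 keeps d = 1/(n + 2) strictly below 1 for every n. *)
move=> iS S0 e0; pose F n : set R := `[0, 1 - n.+2%:R^-1[%classic.
have FI n : F n `<=` I01.
  move=> s; rewrite /F /I01/= !in_itv/= => /andP[-> sn] /=.
  by rewrite (lt_trans sn)// ltrBlDr ltrDl invr_gt0.
have FE : \bigcup_n F n = I01.
  apply/seteqP; split=> [s [n _ /FI]//|s].
  rewrite /I01/= in_itv/= => /andP[s0 s1].
  have [n sn] := ltr_add_invr s1; exists n => //.
  rewrite /F/= in_itv/= s0/= ltrBrDr (le_lt_trans _ sn)// lerD2l.
  by rewrite lef_pV2 ?posrE// ler_nat.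
have mF n : measurable (F n) by exact: measurable_itv.
have iF n : itg (F n) S := itgS (mF n) measurable_I01 (FI n) iS.
have cF : (\int[mu]_(x in F i) (S x)%:E @[i --> \oo] -->
    \int[mu]_(x in \bigcup_i F i) (S x)%:E)%E.
  apply: ge0_nondecreasing_set_cvg_integral => //.
  - move=> n m nm; apply/subsetPset => s; rewrite /F/= !in_itv/=.
    move=> /andP[-> sn] /=; rewrite (lt_le_trans sn)// lerD2l lerN2.
    by rewrite lef_pV2 ?posrE// ler_nat.
  - by move=> n; exact: (@measurable_int _ _ R mu _ _ (iF n)).
  - by move=> n s /FI Is; rewrite lee_fin S0.
rewrite FE (EFin_Rint measurable_I01 iS) in cF.
have /near_gt_ereal/cF : ((\int[mu]_(s in I01) S s - e)%:E <
    (\int[mu]_(s in I01) S s)%:E)%E by rewrite lte_fin ltrBlDr ltrDl.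
move=> [n _ /(_ n (leqnn n))]; rewrite /= (EFin_Rint (mF n) (iF n)) lte_fin => h.
by exists n.+2%:R^-1 => //; rewrite invr_gt0 ltr0n invf_lt1// ltr1n.
Qed.

(* For [s] in the cell [[t_(k-1), t_k)] and mesh at most [d] the left endpoint
   is at least [s - d]; translating by [d] only loses the tail of [S] on
   [[1 - d, 1)]. *)
Lemma left_sum_ge S d j : itg I01 S -> (forall s, I01 s -> 0 <= S s) ->
  (forall s t, I01 s -> I01 t -> s <= t -> S s <= S t) -> 0 < d < 1 ->
  (forall s k, d <= s -> cell k s -> s - d <= tpred (j := j) k) ->
  \int[mu]_(s in `[0, 1 - d[) S s <=
  \sum_(k < size j) (tnext k - tpred k) * S (tpred k).
Proof.
move=> iS S0 Si /andP[d0 d1] jd.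
(* [T] takes on each cell the value of [S] at its left end, so its integral is the sum to be
   bounded. *)
pose T s := \sum_(k < size j) \1_(cell k) s * S (tpred k).
have iTk k : itg I01 (fun s => \1_(@cell _ j k) s * S (tpred k)).
  by apply: itg_indic_mul => //; exact: itg_cst.
have iT : itg I01 T by exact: itg_sum.
have TE k s : cell k s -> T s = S (tpred (j := j) k).
  move=> ks; rewrite /T (bigD1 k)//= big1 => [|l /negbTE lk].
    by rewrite (cell_indic _ ks) eqxx mul1r addr0.
  by rewrite (cell_indic _ ks) lk mul0r.
have Ik k : I01 (tpred (j := j) k) := cell_sub (cell_tpred k).
have T0 s : I01 s -> 0 <= T s.
  by move=> /(cell_cover j)[k ks]; rewrite (TE _ _ ks) S0.
have -> : \sum_(k < size j) (tnext k - tpred k) * S (tpred k) =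
    \int[mu]_(s in I01) T s.
  rewrite Rintegral_sum//; apply: eq_bigr => k _.
  rewrite (Rintegral_indic_mul (fun=> S (tpred k)) (@cell_sub _ _ k)).
  by rewrite Rint_cst_cell mulrC.
pose D0 : set R := `[0, 1 - d[%classic; pose D1 : set R := `[d, 1[%classic.
have mD : measurable D0 by exact: measurable_itv.
have md1 : measurable D1 by exact: measurable_itv.
have DI : D0 `<=` @I01 R.
  move=> s; rewrite /D0 /D1 /I01/= !in_itv/= => /andP[-> sd] /=.
  by rewrite (lt_trans sd)// ltrBlDr ltrDl.
have dI : D1 `<=` @I01 R.
  move=> s; rewrite /D0 /D1 /I01/= !in_itv/= => /andP[ds ->].
  by rewrite (le_trans _ ds)// ltW.
have iD := itgS mD measurable_I01 DI iS.
rewrite -lee_fin -(EFin_Rint mD iD) -(EFin_Rint measurable_I01 iT).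
pose phi : measurableTypeR R -> measurableTypeR R := fun s => s - d.
have msh : measurable_fun setT phi.
  exact: measurable_funB.
have preE : phi @^-1` D0 = D1.
  by apply/seteqP; split=> s; rewrite /D0 /D1/= !in_itv/= subr_ge0 ltrD2r.
have mS := itg_measurable iD.
have mSE : measurable_fun D0 (fun s => (S s)%:E).
  exact/measurable_EFinP.
(* Change of variables: translating by [d] turns the integral of [S] over [0, 1 - d) into that of
   S(s - d) over [d, 1). *)
apply: (@le_trans _ _ (\int[mu]_(s in D1) (S (phi s))%:E)%E).
  rewrite (_ : (\int[mu]_(s in D1) _ =
      \int[pushforward mu phi]_(s in
        D0) (S s)%:E)%E); last first.
    rewrite ge0_integral_pushforward// ?preE//.
    by move=> s; rewrite inE => /DI/S0; rewrite lee_fin.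
  rewrite le_eqVlt; apply/orP; left; apply/eqP.
  by apply: eq_measure_integral => //= A mA AS; exact/esym/lebesgue_measure_shift.
(* On [d, 1) the mesh condition and monotonicity give S(s - d) <= T(s); enlarging the domain to [0,
   1) then only adds mass, as T >= 0. *)
apply: (@le_trans _ _ (\int[mu]_(s in D1) (T s)%:E)%E).
  apply: ge0_le_integral => //.
  - move=> s; rewrite /D1/= in_itv/= => /andP[ds s1]; rewrite lee_fin S0//.
    by rewrite /I01/= in_itv/= subr_ge0 ds/= ltrBlDr (lt_trans s1)// ltrDl.
  - apply/measurable_EFinP.
    apply: (@measurable_comp _ _ _ _ _ _ D0 S _ phi) => //.
      by rewrite -preE; exact: image_preimage_subset.
    exact: measurable_funS msh.
  - apply/measurable_EFinP; exact: itg_measurable (itgS md1 measurable_I01 dI iT).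
  - move=> s sd1; rewrite lee_fin; have Is := dI _ sd1.
    move: sd1; rewrite /D1/= in_itv/= => /andP[ds s1].
    have [k ks] := cell_cover j Is; rewrite (TE _ _ ks); apply: Si => //.
      by rewrite /I01/= in_itv/= subr_ge0 ds/= ltrBlDr (lt_trans s1)// ltrDl.
    exact: jd.
apply: ge0_subset_integral => //; first exact: measurable_I01.
  by apply/measurable_EFinP; exact: itg_measurable.
Qed.

End shift.

(** * Mesh of the partitions in a generating collection *)

Section mesh.
Context {R : realType}.
Implicit Types (J : set (partition01 R)) (j : partition01 R) (a b d s p : R).

Lemma pts_index j p : p \in pts j -> exists k : 'I_(size j), tnext k = p.
Proof.
move=> pj; have kj : (index p (pts j) < size j)%N by rewrite index_mem.
by exists (Ordinal kj); rewrite /tnext/= nth_index.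
Qed.

(** No partition point lies strictly between the left end of the cell of [s] and [s] itself. *)
Lemma pts_le_tpred j p s (k : 'I_(size j)) : p \in pts j -> p <= s -> cell k s ->
  p <= tpred k.
Proof.
move=> /pts_index[l <-] ls /cellE/andP[_ sk].
have [lk|kl] := ltnP l k; first exact: tnext_le_tpred.
have : tnext k <= tnext l by apply: (@pts_le _ j k.+1 l.+1); rewrite ltnS kl/=.
by move=> /le_trans/(_ ls); rewrite leNgt sk.
Qed.

Lemma tpred_pts j (k : 'I_(size j)) : tpred k = 0 \/ tpred k \in pts j.
Proof.
case: k => [[|k] kj]; first by left.
by right; rewrite /tpred/= mem_nth// ltnW.
Qed.

Lemma tnext_pts j (k : 'I_(size j)) : tnext k \in pts j.
Proof. by rewrite /tnext mem_nth. Qed.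

(* If no partition point lies in [(a, b)], every set of the generated
   sigma-algebra contains all of [(a, b)] or none of it. *)
Lemma generating_dense J a b : generating J -> 0 <= a -> a < b -> b <= 1 ->
  exists2 j, J j & exists2 p, p \in pts j & a < p < b.
Proof.
move=> [_ GJ] a0 ab b1; apply: contrapT => noJ.
have nop j p : J j -> p \in pts j -> a < p < b -> False.
  by move=> Jj pj apb; apply: noJ; exists j => //; exists p.
(* The sets that do not separate points of (a, b). They form a sigma-algebra containing every cell,
   hence all Borel subsets of [0, 1). *)
pose GG := [set A : set R | forall x y, a < x < b -> a < y < b -> A x -> A y].
have abI x : a < x < b -> I01 x.
  move=> /andP[ax xb]; rewrite /I01/= in_itv/=.
  by rewrite (le_trans a0) ?(ltW ax)//= (lt_le_trans xb).
have sGG : sigma_algebra I01 GG.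
  split=> [x y _ _ //|A GA x y xab yab [Ix nAx]|A GA x y xab yab [n _ Anx]].
    by split; [exact: abI|move=> Ay; apply: nAx; exact: (GA y x)].
  by exists n => //; exact: (GA n x y).
have sub : <<s I01, \bigcup_(j in J) <<s I01, range (@cell R j)>> >> `<=` GG.
  apply: smallest_sub => // A [j Jj]; apply: smallest_sub => // _ [k _ <-] x y.
  move=> /andP[ax xb] /andP[ay yb] /cellE/andP[kx xk]; apply/cellE/andP; split.
    have [->|kj] := tpred_pts k; first by rewrite (le_trans a0)// ltW.
    rewrite leNgt; apply/negP => yk; apply: (nop _ _ Jj kj).
    by rewrite (lt_trans ay yk) (le_lt_trans kx xb).
  rewrite ltNge; apply/negP => ky; apply: (nop _ _ Jj (tnext_pts k)).
  by rewrite (lt_trans ax xk) (le_lt_trans ky yb).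
(* Contradiction: this Borel set separates the midpoint of (a, b) from the three-quarter point. *)
have : GG `]a, (a + b) / 2]%classic.
  apply: sub; rewrite GJ; split; first exact: measurable_itv.
  move=> x; rewrite /= in_itv/= => /andP[ax xc]; apply: abI; rewrite ax/=.
  by apply: (le_lt_trans xc); lra.
move=> /(_ ((a + b) / 2) (((a + b) / 2 + b) / 2)); rewrite /= !in_itv/=.
have -> : a < (a + b) / 2 < b by apply/andP; split; lra.
have -> : a < ((a + b) / 2 + b) / 2 < b by apply/andP; split; lra.
move=> /(_ isT isT); rewrite lexx.
have -> : a < (a + b) / 2 by lra.
by move=> /(_ isT)/andP[_]; lra.
Qed.

Lemma refines_trans j1 j2 j3 : refines j1 j2 -> refines j2 j3 -> refines j1 j3.
Proof. by move=> h12 h23 p /h23/h12. Qed.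

(** Cut [0, 1) into N intervals with 1/N < d/2 and put a partition point in each. The grid interval
    just before the one containing [s] then holds a partition point within 2/N < d of [s]. *)
Lemma generating_mesh J d : generating J -> 0 < d ->
  exists2 j0, J j0 & forall j, refines j j0 ->
    forall s k, d <= s -> cell k s -> s - d <= tpred (j := j) k.
Proof.
move=> GJ d0; have [dirJ _] := GJ.
have [n] : exists n, 0 + n.+1%:R^-1 < d / 2 by apply: ltr_add_invr; rewrite divr_gt0.
rewrite add0r => nd; set N : R := n.+1%:R in nd.
have N0 : 0 < N by rewrite ltr0n.
have [j0 Jj0 j0P] : exists2 j0, J j0 & forall i, (i < n.+1)%N ->
    exists2 p, p \in pts j0 & i%:R / N < p < i.+1%:R / N.
  have : (n.+1 <= n.+1)%N by [].
  (* Induction on the number of grid intervals already hit; directedness merges the new partition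
     with the previous one. *)
  elim: {1 3}n.+1 => [_|M IH Mn].
    by have [j Jj _] := generating_dense GJ (lexx 0) ltr01 (lexx 1); exists j.
  have [j1 Jj1 j1P] := IH (ltnW Mn).
  have [|||j2 Jj2 [p pj2 pM]] := @generating_dense J (M%:R / N) (M.+1%:R / N) GJ.
  - by rewrite divr_ge0.
  - by rewrite ltr_pM2r ?invr_gt0// ltr_nat.
  - by rewrite ler_pdivrMr// mul1r ler_nat.
  have [j Jj [jj1 jj2]] := dirJ _ _ Jj1 Jj2; exists j => // i.
  rewrite ltnS leq_eqVlt => /predU1P[->|/j1P[q qj1 qi]].
    by exists p => //; exact: jj2.
  by exists q => //; exact: jj1.
exists j0 => // j jj0 s k ds ks.
have := cell_sub ks; rewrite /I01/= in_itv/= => /andP[s0 s1].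
have /andP[ts st] := truncn_itv (mulr_ge0 s0 (ltW N0)).
have dN : 2 < d * N by rewrite -ltr_pdivrMr// mulrC -ltr_pdivlMr.
have sN : d * N <= s * N by rewrite ler_pM2r.
(* The integer part of s N is not 0, since s N >= d N > 2; written i + 1, it makes i the index of
   the preceding grid interval. *)
move: ts st; case: (Num.truncn _) => [|i] ts st; first by lra.
have [|p pj0 /andP[ip pi]] := j0P i.
  by rewrite -(ltr_nat R) (lt_le_trans _ (lexx N))// (le_lt_trans _ (_ : s * N < N))
     ?gtr_pMl// (le_trans _ ts)// ler_nat.
apply: (@le_trans _ _ p); last first.
  apply: (pts_le_tpred (jj0 _ pj0) _ ks); rewrite (le_trans (ltW pi))//.
  by rewrite ler_pdivrMr.
apply/ltW; apply: le_lt_trans ip; rewrite ler_pdivlMr// mulrBl.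
by move: st; rewrite -addn2 natrD; lra.
Qed.

End mesh.

(** * Strong convergence of the averaging operators on the cone *)

Section approximation.
Context {R : realType} {D : nat}.
Local Notation mu := (@lebesgue_measure R).
Implicit Types (f g : R -> 'M[R]_D) (J : set (partition01 R)).

Lemma dotHjC (j : partition01 R) (x y : 'I_(size j) -> 'M[R]_D) :
  dotHj x y = dotHj y x.
Proof. by apply: eq_bigr => k _; rewrite dotSC. Qed.

(** P_j is an orthogonal projection: adjointness together with [projj_liftj] makes the two cross
    terms and the last term coincide up to sign. *)
Lemma dotH_defect (j : partition01 R) f g : L2S f -> L2S g ->
  dotH (fun s => f s - liftj (projj j f) s) (fun s => g s - liftj (projj j g) s)
  = dotH f g - dotHj (projj j f) (projj j g).
Proof.
move=> Lf Lg.
have sp (h : R -> 'M[R]_D) k : L2S h -> symS (projj j h k).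
  by move=> Lh; exact: symS_projj.
have Lp (h : R -> 'M[R]_D) : L2S h -> L2S (liftj (projj j h)).
  by move=> Lh; apply: L2S_liftj => k; exact: sp.
have Lpf := Lp _ Lf; have Lpg := Lp _ Lg.
have Ld := L2SB Lg Lpg.
rewrite dotHBl// !dotHBr// [dotH f (liftj _)]dotHC !dotH_liftj//;
  do ?by move=> k; exact: sp.
rewrite projj_liftj [dotHj (projj j g) _]dotHjC; ring.
Qed.

(** By [dotH_defect] the quantity bounded is |f - P_j f|^2, so this is the convergence of P_j f to f
    in H. *)
Lemma coneC_approx J f (e : R) : generating J -> coneC R D f -> 0 < e ->
  exists2 j0, J j0 & forall j, refines j j0 ->
    dotH f f - dotHj (projj j f) (projj j f) < e.
Proof.
move=> GJ /coneC_monoS[Lf [m mm fm]] e0; have [Lm pm im] := mm.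
pose S s := dotS (m s) (m s).
have iS : mu.-integrable I01 (EFin \o S) by exact: itg_L2S.
have S0 s : I01 s -> 0 <= S s by move=> /pm[sm _]; exact: dotS_ge0.
have Si s t : I01 s -> I01 t -> s <= t -> S s <= S t.
  by move=> Is It st; apply: le_psdS_dot; [exact: pm|exact: im].
have [d d01 dS] := tail_integral iS S0 e0.
have d0 : 0 < d by case/andP : d01.
have [j0 Jj0 j0P] := generating_mesh GJ d0; exists j0 => // j /j0P jd.
have Ik k : I01 (tpred (j := j) k) := cell_sub (cell_tpred k).
rewrite (eq_projj j Lf Lm fm) (eq_dotHl Lf Lm Lf fm) dotHC (eq_dotHl Lf Lm Lm fm).
rewrite ltrBlDr -ltrBlDl; apply: (lt_le_trans dS).
apply: (le_trans (left_sum_ge iS S0 Si d01 jd)).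
(* The sum of left-end values of |m|^2 is termwise at most |p_j m|^2. *)
apply: ler_sum => k _; rewrite ler_pM2l ?subr_gt0 ?lt_tpred_tnext//.
by apply: le_psdS_dot; [exact: pm|exact: projj_ge_tpred].
Qed.

End approximation.

(** * Convergence of the pairings and of the norm distance *)

Section duality.
Context {R : realType} {D : nat}.
Implicit Types (f g rho nu mu : R -> 'M[R]_D) (j : partition01 R).

Lemma dotHjBl j (x y z : 'I_(size j) -> 'M[R]_D) :
  dotHj (fun k => x k - y k) z = dotHj x z - dotHj y z.
Proof.
rewrite /dotHj -sumrB; apply: eq_bigr => k _.
by rewrite dotSBl mulrBr.
Qed.

Lemma L2S_coneCj j (x : 'I_(size j) -> 'M[R]_D) : coneCj D j x -> L2S (liftj x).
Proof. by move=> [px _]; apply: L2S_liftj => k; case: (px k). Qed.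

Lemma dotH_liftj_coneCj j (x : 'I_(size j) -> 'M[R]_D) f : coneCj D j x ->
  L2S f -> dotH (liftj x) f = dotHj x (projj j f).
Proof. by move=> [px _] Lf; apply: dotH_liftj => // k; case: (px k). Qed.

Lemma dotHBB f g : L2S f -> L2S g ->
  dotH (fun s => f s - g s) (fun s => f s - g s) =
  dotH f f - 2 * dotH f g + dotH g g.
Proof.
move=> Lf Lg; have Ld := L2SB Lf Lg.
by rewrite (dotHBl Lf Lg Ld) (dotHBr Lf Lg Lf) (dotHBr Lf Lg Lg) (dotHC g f); ring.
Qed.

(** With a = mu - P_j mu and b = rho - P_j rho, the loss is <a, b> <= (|a|^2 + |b|^2) / 2, and both
    squares are below [e] for fine [j]. *)
Lemma coneC_dotH_approx (J : set (partition01 R)) mu rho (e : R) :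
  generating J -> coneC R D mu -> coneC R D rho -> 0 < e ->
  exists2 j0, J j0 & forall j, refines j j0 ->
    dotH mu rho - e < dotHj (projj j mu) (projj j rho).
Proof.
move=> GJ Cmu Crho e0; have [dirJ _] := GJ.
have [j1 Jj1 j1P] := coneC_approx GJ Cmu e0.
have [j2 Jj2 j2P] := coneC_approx GJ Crho e0.
have [j0 Jj0 [j01 j02]] := dirJ _ _ Jj1 Jj2; exists j0 => // j jj0.
have {}j1P := j1P j (refines_trans jj0 j01).
have {}j2P := j2P j (refines_trans jj0 j02).
have [[Lmu _] [Lrho _]] := (Cmu, Crho).
have Lp f : L2S f -> L2S (fun s => f s - liftj (projj j f) s).
  move=> Lf; apply: L2SB => //; apply: L2S_liftj => k; exact: symS_projj.
have := dotH_ge0 (L2SB (Lp _ Lmu) (Lp _ Lrho)).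
rewrite (dotHBB (Lp _ Lmu) (Lp _ Lrho)).
rewrite (dotH_defect j Lmu Lmu) (dotH_defect j Lmu Lrho) (dotH_defect j Lrho Lrho).
lra.
Qed.

Lemma normH_projj_lt j rho (d : R) : coneC R D rho -> 0 < d ->
  dotH rho rho - dotHj (projj j rho) (projj j rho) < d ^+ 2 ->
  normH (fun s => liftj (projj j rho) s - rho s) < d.
Proof.
move=> Crho d0 h; have [Lrho _] := Crho.
have Lp := L2S_coneCj (coneCj_projj j Crho).
rewrite -(ger0_norm (ltW d0)) -sqrtr_sqr /normH ltr_sqrt ?exprn_gt0//.
apply: le_lt_trans h; rewrite -(dotH_defect j Lrho Lrho).
by rewrite (dotHBB Lp Lrho) (dotHBB Lrho Lp) (dotHC rho); lra.
Qed.

End duality.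

(** * The limit of the discrete formulas against the continuous one *)

Theorem proposition3p14 (R : realType) (D : nat) (hD : (0 < D)%N)
  (J : set (partition01 R)) (hJ : generating J)
  (psi : (R -> 'M[R]_D) -> R) (hpsi : Cdual_increasing psi)
  (H : (R -> 'M[R]_D) -> R) (hH : L2_continuous H)
  (f_ : forall j : partition01 R, R -> ('I_(size j) -> 'M[R]_D) -> \bar R)
  (hf : forall j, J j -> forall (t : R) (x : 'I_(size j) -> 'M[R]_D), 0 <= t -> coneCj D j x ->
     f_ j t x = ereal_sup [set
       ereal_inf [set
         (psi (liftj y) + dotHj (fun k => x k - y k) z
            + t * H (liftj z))%:E
         | y in coneCj D j]
       | z in coneCj D j])
  (t : R) (ht : 0 <= t) (mu : R -> 'M[R]_D) (hmu : coneC R D mu)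
  (l : R) (hl : net_cvg J (fun j => f_ j t (projj j mu)) l%:E) :
  l%:E = ereal_sup [set
    ereal_inf [set
      (psi nu + dotH (fun s => mu s - nu s) rho + t * H rho)%:E
      | nu in coneC R D]
    | rho in coneC R D].
Proof.
set G := fun rho => ereal_inf [set
  (psi nu + dotH (fun s => mu s - nu s) rho + t * H rho)%:E
  | nu in coneC R D].
have [Lmu _] := hmu.
have Cjmu j := coneCj_projj j hmu.
apply/eqP; rewrite eq_le; apply/andP; split.
  (* Upper bound on the limit: it suffices to bound one f_j exceeding l - e, and each [z] is matched
     by the step function rho = l_j z. *)
  apply/lee_subgt0Pr => e e0.
  have /near_gt_ereal/hl[j0 Jj0 /(_ j0 Jj0 (fun _ => id))] :
    (l%:E - e%:E < l%:E)%E by rewrite -EFinB lte_fin ltrBlDr ltrDl.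
  move=> /= /ltW/le_trans; apply.
  rewrite hf//; apply/ereal_supP => _ [z Cz <-].
  have Clz : coneC R D (liftj z) := coneC_liftj Cz.
  have [Lz _] := Clz.
  apply: le_trans (ereal_sup_ubound _); last by exists (liftj z).
  apply/ereal_infP => _ [nu Cnu <-]; have [Lnu _] := Cnu.
  have Cpnu := coneCj_projj j0 Cnu.
  (* Competitor y = p_j nu: adjointness makes the pairings with [z] agree, leaving psi(P_j nu) <=
     psi(nu). *)
  apply: le_trans (ereal_inf_lbound _) _; first by exists (projj j0 nu).
  rewrite lee_fin lerD2r dotHjBl dotHBl// ![dotH _ (liftj z)]dotHC.
  rewrite !dotH_liftj_coneCj// ![dotHj z _]dotHjC lerD2r.
  by apply: hpsi => //; [exact: coneC_liftj|exact: projj_dual].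
apply/ereal_supP => _ [rho Crho <-]; have [Lrho _] := Crho.
apply/lee_addgt0Pr => e e0; have e3 : 0 < e / 3 by rewrite divr_gt0.
have [dirJ _] := hJ.
have [j1 Jj1 j1P] := coneC_dotH_approx hJ hmu Crho e3.
(* The tolerance for [H] is (e / 3) / (t + 1), so that t = 0 is covered and the factor [t] costs at
   most e / 3. *)
have t1 : 0 < t + 1 by rewrite ltr_wpDl.
have [d d0 dP] := hH _ Lrho _ (divr_gt0 e3 t1).
have [j2 Jj2 j2P] := coneC_approx hJ Crho (exprn_gt0 2 d0).
have /near_lt_ereal/hl[j3 Jj3 j3P] : (l%:E < (l + e / 3)%:E)%E.
  by rewrite lte_fin ltrDl.
have [j4 Jj4 [j41 j42]] := dirJ _ _ Jj1 Jj2.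
have [j Jj [j4j j3j]] := dirJ _ _ Jj4 Jj3.
have {}j1P := j1P j (refines_trans j4j j41).
have {}j2P := j2P j (refines_trans j4j j42).
have {}j3P := j3P j Jj j3j.
have Cjrho := coneCj_projj j Crho.
have HP := dP _ (L2S_coneCj Cjrho) (normH_projj_lt Crho d0 j2P).
have tH : t * H rho - t * H (liftj (projj j rho)) <= e / 3.
  rewrite -mulrBr; apply: (@le_trans _ _ (t * (e / 3 / (t + 1)))).
    by rewrite ler_wpM2l// ltW// (le_lt_trans (ler_norm _))// distrC.
  by rewrite mulrA ler_pdivrMr// mulrC ler_wpM2l ?(ltW e3)// lerDl.
(* Insert z = p_j rho. Any [y] lifts to a competitor for [G rho]; one e / 3 pays for the pairing of
   mu and rho, the other for [H]. The third e / 3 is the gap between f_j and [l]. *)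
have low : (G rho - (e / 3 + e / 3)%:E <= f_ j t (projj j mu))%E.
  rewrite hf//; apply: le_trans (ereal_sup_ubound _); last first.
    by exists (projj j rho).
  apply/ereal_infP => _ [y Cy <-]; have [Ly _] := coneC_liftj Cy.
  rewrite leeBlDr//; apply: (le_trans (ereal_inf_lbound _)).
    by exists (liftj y) => //; exact: coneC_liftj.
  rewrite -EFinD lee_fin dotHjBl dotHBl// (dotH_liftj_coneCj Cy Lrho).
  by move: j1P tH; lra.
rewrite -[X in (X <= _)%E](@subeK _ _ (e / 3 + e / 3)%:E)//.
apply: (@le_trans _ _ ((l + e / 3)%:E + (e / 3 + e / 3)%:E)%E).
  by rewrite leeD2r// (le_trans low)// ltW.
by rewrite -!EFinD lee_fin; lra.
Qed.
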